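(* Let $d$ and $k$ be integers with $1\le k\le d$, and let $p,q$ be two data items in a $d$-dimensional space $S$, i.e. $p=(p_1,\dots,p_d)$ and $q=(q_1,\dots,q_d)$ are vectors of real values. Let $p_{\min}(k),q_{\min}(k)\in\{0,1,\dots,k-1\}$ be the chosen index positions for $p$ and $q$, and let $MI_{\min}(\cdot,k)$ and $MI_{\max}(\cdot,k)$ be the associated thresholds. If $q_{\min}(k)=p_{\min}(k)$ and $MI_{\max}(p,k)<MI_{\min}(q,k)$, then $q$ does not $k$-dominate $p$.
   Context: A data item $u$ in a $d$-dimensional space is a vector $(u_1,\dots,u_d)$ of real attribute values, where $u_j$ is its value in dimension $j$. The values are assumed already normalized, so that all dimensions take values in a common range and values in different dimensions can be compared as real numbers. $k$-dominance: for data items $a,b$, the item $a$ $k$-dominates $b$ (written $a\prec_k b$) if and only if (1) there is a set $S'\subseteq\{1,\dots,d\}$ of dimensions with $|S'|\ge k$ such that $a_j\le b_j$ for all $j\in S'$, and (2) there is some $j'\in\{1,\dots,d\}$ with $a_{j'}<b_{j'}$. Sorted item: for a data item $u$, $SORTED(u)$ is the list of its $d$ values rearranged in ascending (non-decreasing) order, indexed from $0$ to $d-1$; $SORTED(u)[i]$ is the entry at index $i$. Pointers and thresholds: for each item $u$ an index position $u_{\min}(k)\in\{0,1,\dots,k-1\}$ is chosen, and one sets $$u_{\max}(k)=u_{\min}(k)+(d-k),$$ $$MI_{\min}(u,k)=SORTED(u)[u_{\min}(k)],\qquad MI_{\max}(u,k)=SORTED(u)[u_{\max}(k)].$$ *)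

(* Defs.v *)
From mathcomp Require Import all_boot all_order all_algebra.
From mathcomp Require Import reals.

Set Implicit Arguments.
Unset Strict Implicit.
Unset Printing Implicit Defensive.

Import Order.TTheory GRing.Theory Num.Theory.
Local Open Scope ring_scope.

Section KDominance.
Variables (R : realType) (d : nat).

(* A data item u is a row vector; its value in dimension j is u 0 j. *)
Implicit Types a b u : 'rV[R]_d.

(* The strict dimension j' of the second clause is not required to lie in S. *)
Definition k_dominates (k : nat) a b : Prop :=
  (exists S : {set 'I_d},
     (k <= #|S|)%N /\ forall j, j \in S -> a 0 j <= b 0 j) /\
  (exists j' : 'I_d, a 0 j' < b 0 j').

Definition SORTED u : seq R := sort <=%O [seq u 0 j | j <- enum 'I_d].

(* m : 'I_k is the chosen position u_min(k), which ranges over 0, ..., k-1. *)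
Definition max_pos (k : nat) (m : 'I_k) : nat := (m + (d - k))%N.

(* For k <= d both positions are smaller than d = size (SORTED u), so the
   default value 0 of nth is never returned. *)
Definition MI_min (k : nat) u (m : 'I_k) : R := nth 0 (SORTED u) m.

Definition MI_max (k : nat) u (m : 'I_k) : R := nth 0 (SORTED u) (max_pos m).

End KDominance.

(* Main.v *)
(** Write m for the common position, x = MI_max(p) and y = MI_min(q). At least
    m + (d - k) + 1 coordinates of p are at most x, so a set of k dimensions on
    which q is at most p contains at least m + 1 of them; there q <= p <= x < y,
    whereas at most m coordinates of q are below y. *)
Require Import Defs.
From mathcomp Require Import all_boot all_order all_algebra.
From mathcomp Require Import reals zify.

Set Implicit Arguments.
Unset Strict Implicit.
Unset Printing Implicit Defensive.

Import Order.TTheory GRing.Theory Num.Theory.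
Local Open Scope ring_scope.

Lemma size_SORTED (R : realType) (d : nat) (u : 'rV[R]_d) :
  size (SORTED u) = d.
Proof. by rewrite size_sort size_map size_enum_ord. Qed.

Lemma count_SORTED (R : realType) (d : nat) (u : 'rV[R]_d) (P : pred R) :
  count P (SORTED u) = #|[set j | P (u 0 j)]|.
Proof.
rewrite count_sort count_map cardsE cardE -size_filter.
by congr (size _); rewrite enumT.
Qed.

(** If more than [i] values lay below the entry at index [i], they would fill the indices [0] to [i]
    of the sorted list, and that entry would be below itself. *)
Lemma card_lt_nth_SORTED (R : realType) (d i : nat) (u : 'rV[R]_d) :
  (#|[set j | (u 0 j < nth 0 (SORTED u) i)%R]| <= i)%N.
Proof.
rewrite -(count_SORTED u (fun z => z < _)) leqNgt; apply/negP => lt_i.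
by have := nth_count_lt 0 (sort_le_sorted _) lt_i; rewrite ltxx.
Qed.

(** With at most [i] values up to the entry at index [i], that entry would exceed itself; [i < d]
    keeps the index inside the list. *)
Lemma card_le_nth_SORTED (R : realType) (d i : nat) (u : 'rV[R]_d) :
  (i < d)%N -> (i < #|[set j | (u 0 j <= nth 0 (SORTED u) i)%R]|)%N.
Proof.
move=> lt_id; rewrite -(count_SORTED u (fun z => z <= _)) ltnNge.
apply/negP => le_i.
have lt_is : (i < size (SORTED u))%N by rewrite size_SORTED.
have bounds := introT andP (conj le_i lt_is).
by have := nth_count_gt 0 (sort_le_sorted _) bounds; rewrite ltxx.
Qed.

Theorem theorem1 (R : realType) (d k : nat) (hk1 : (1 <= k)%N) (hkd : (k <= d)%N)
    (p q : 'rV[R]_d) (pmin qmin : 'I_k)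
    (hmin : qmin = pmin)
    (hMI : MI_max p pmin < MI_min q qmin) :
  ~ k_dominates k q p.
Proof.
move=> [[S [le_kS le_qp]] _]; subst qmin.
have lt_mk := ltn_ord pmin.
have lt_max : (max_pos d pmin < d)%N by rewrite /max_pos; lia.
have le_m := card_lt_nth_SORTED pmin q.
have gt_max := card_le_nth_SORTED p lt_max.
rewrite -/(MI_min q pmin) in le_m; rewrite -/(MI_max p pmin) in gt_max.
set A := [set j | _] in le_m; set B := [set j | _] in gt_max.
have sub : S :&: B \subset A.
  apply/subsetP => j; rewrite !inE => /andP[jS le_px].
  exact: le_lt_trans (le_trans (le_qp j jS) le_px) hMI.
have le_U : (#|S :|: B| <= d)%N by rewrite -[leqRHS]card_ord max_card.
have le_I := leq_trans (subset_leq_card sub) le_m.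
(* Inclusion-exclusion: [#|S| + #|B|] is at least [k + (m + (d - k) + 1) = d + m + 1], yet it equals
   [#|S :|: B| + #|S :&: B|], which is at most [d + m]. *)
have := leq_trans (leq_add le_kS gt_max) (eq_leq (esym (cardsUI S B))).
by move/leq_trans => /(_ _ (leq_add le_U le_I)); rewrite /max_pos; lia.
Qed.
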